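(* Let $P=(\mathrm{Vars},V,E,v_{\mathrm{init}},v_{\mathrm{acc}},v_{\mathrm{rej}})$ be a loop-free probabilistic program (control flow automaton) in static single assignment form, let $R\subseteq\mathrm{Vars}$ be its set of probabilistically assigned variables, and let $\varphi_{\mathrm{acc}}$ and $\varphi_{\mathrm{term}}$ be the formulas (with free variables $R$) defined below. Then $\mathrm{Accept}=[\![\varphi_{\mathrm{acc}}]\!]$ and $\mathrm{Term}=[\![\varphi_{\mathrm{term}}]\!]$, where each free variable $r\in R$ is interpreted over its domain with measure $\mathrm{dist}(r)$. Consequently $\mathrm{val}(P)=\#\varphi_{\mathrm{acc}}/\#\varphi_{\mathrm{term}}$, where $\#\varphi$ denotes the measure of the set $[\![\varphi]\!]$ of models of $\varphi$ with respect to the product of the measures $\mathrm{dist}(r)$, $r\in R$.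
   Context: Programs. A program has a finite set of variables $\mathrm{Vars}$, partitioned into Boolean, integer and real-valued variables (expressions are type-correct). Basic statements are: $\mathsf{skip}$; deterministic assignments $x:=e$; probabilistic assignments $x\sim\mathsf{Uniform}(a,b)$ with constants $a,b$ (sampling uniformly from $[a,b]$, i.e. from the real interval for a real variable and from the integers in $[a,b]$ for an integer variable); and $\mathsf{assume}(\psi)$, where $e,\psi$ are an expression and a predicate. A control flow automaton (CFA) $P=(\mathrm{Vars},V,E,v_{\mathrm{init}},v_{\mathrm{acc}},v_{\mathrm{rej}})$ consists of $\mathrm{Vars}$, a finite directed acyclic graph $(V,E)$ with labeled edges $E\subseteq V\times\mathcal{S}\times V$ ($\mathcal{S}$ the set of basic statements), an initial vertex $v_{\mathrm{init}}$ with no incoming edges, and accepting and rejecting vertices $v_{\mathrm{acc}},v_{\mathrm{rej}}$ with no outgoing edges. The program is in SSA form: each variable is assigned at most once along any path. Let $R=\{x\mid x\sim\mathsf{Uniform}(a,b)\text{ is a statement of }P\}$ and for $r\in R$ let $\mathrm{dist}(r)$ be the uniform distribution $\mathsf{Uniform}(a,b)$ of its (unique) probabilistic assignment; the other variables $\mathrm{Vars}\setminus R$ are nondeterministic. A scenario $\omega$ is an assignment of values to $R$, drawn from the product of the distributions $\mathrm{dist}(r)$. Semantics. For a scenario $\omega$, the program reaches a vertex $u$ if there is a path $v_{\mathrm{init}}=u_0\xrightarrow{s_1}u_1\cdots\xrightarrow{s_n}u_n=u$ in the CFA and a sequence of variable valuations, starting arbitrarily, such that along the path $\mathsf{skip}$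 and $\mathsf{assume}(\psi)$ leave the valuation unchanged and require (for $\mathsf{assume}$) that $\psi$ holds in the current valuation, $x:=e$ updates $x$ to the value of $e$, and $x\sim\mathsf{Uniform}(a,b)$ sets $x$ to the value $\omega(x)$. Define $\mathrm{Term}$ as the set of scenarios $\omega$ under which the program reaches $v_{\mathrm{acc}}$ or $v_{\mathrm{rej}}$ (for some choice of the nondeterministic values), and $\mathrm{Accept}$ as the set of scenarios under which it reaches $v_{\mathrm{acc}}$. The value of $P$ is $\mathrm{val}(P)=\Pr[\mathrm{Accept}\mid\mathrm{Term}]=\Pr[\mathrm{Accept}]/\Pr[\mathrm{Term}]$; programs are assumed well-formed, i.e. $\Pr[\mathrm{Term}]$ is bounded away from $0$. Formulas. Let $B_V=\{b_v\mid v\in V\}$ be fresh Boolean variables. Define $\Psi(\mathsf{skip})=\mathit{true}$, $\Psi(x:=e)$ is $x=e$, $\Psi(x\sim\mathsf{Uniform}(a,b))=\mathit{true}$, $\Psi(\mathsf{assume}(\psi))=\psi$. The verification condition is $$\mathrm{VC}(P)=\bigwedge_{v\in V\setminus\{v_{\mathrm{init}}\}}\Bigl[b_v\Rightarrow\Bigl(\bigvee_{(v',s,v)\in E} b_{v'}\wedge\Psi(s)\Bigr)\Bigr]\wedge b_{v_{\mathrm{init}}},$$ and $\varphi_{\mathrm{acc}}=\exists B_V\,\exists(\mathrm{Vars}\setminus R).\ \mathrm{VC}(P)\wedge b_{v_{\mathrm{acc}}}$, $\varphi_{\mathrm{term}}=\exists B_V\,\exists(\mathrm{Vars}\setminus R).\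 \mathrm{VC}(P)\wedge(b_{v_{\mathrm{acc}}}\vee b_{v_{\mathrm{rej}}})$, both with free variables $R$.
   Formalization: SSA form is taken to include also: no variable is read before or at its assignment on a path, a variable in R is read only after being sampled, and a variable in R has no other assignment; with only ''assigned at most once along any path'' the claim fails, e.g. for assume(x>0); x:=-1. *)

(* Defs.v *)
From Stdlib Require List.
From HB Require Import structures.
From mathcomp Require Import all_boot all_order all_algebra.
From mathcomp Require Import all_classical all_reals all_analysis.

Set Implicit Arguments.
Unset Strict Implicit.
Unset Printing Implicit Defensive.
Import Order.TTheory GRing.Theory Num.Theory numFieldNormedType.Exports.

Local Open Scope classical_set_scope.
Local Open Scope ring_scope.

HB.instance Definition _ := isPointed.Build int 0.
HB.instance Definition _ := @isMeasurable.Build default_measure_display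
  int discrete_measurable discrete_measurable0
  discrete_measurableC discrete_measurableU.

Record pspace (R : realType) := PSpace {
  pdisp : measure_display;
  pcar : measurableType pdisp;
  pmeas : probability pcar R }.

Section product_probability.
Context (R : realType) (I : finType) (d : I -> measure_display).
Context (T : forall i, measurableType (d i)).
Context (P : forall i, probability (T i) R).

Definition cylinders : set (set (forall i, T i)) :=
  [set C | exists i (A : set (T i)), measurable A /\ C = [set w | A (w i)]].

Definition prodT := g_sigma_algebraType cylinders.

(* [iterprod s] is the iterated binary product of the [P i], [i] in [s];
   [assemble s] sends its points to functions on [I], so that the image of the
   measure by [assemble (enum I)] is the product of all the [P i]
   (see [prod_prob_box]). *)
Fixpoint iterprod (s : seq I) : pspace R :=
  if s is i :: s' then PSpace (P i \x pmeas (iterprod s'))%E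
  else PSpace (dirac tt : probability unit R).

Fixpoint assemble (s : seq I) : pcar (iterprod s) -> prodT :=
  match s return pcar (iterprod s) -> prodT with
  | [::] => fun=> point
  | i :: s' => fun p : (T i * pcar (iterprod s'))%type =>
      @dfwith I (fun j => T j) (@assemble s' p.2) i p.1
  end.

Lemma measurable_assemble s : measurable_fun setT (@assemble s).
Proof.
apply: (measurability _ (erefl : @measurable _ prodT = <<s cylinders >>)).
move=> _ [_ [i [A [mA ->]]] <-]; rewrite setTI.
elim: s => [|j s ih] /=.
  by rewrite preimage_cst; case: ifP.
have [ij|ij] := eqVneq j i.
  subst j.
  have -> : (fun p : T i * pcar (iterprod s) =>
     @dfwith I (fun j => T j) (assemble p.2) i p.1) @^-1`
     [set w | A (w i)] = A `*` setT.
    by apply/seteqP; split=> [[x y]|[x y] []] /=; rewrite dfwithin.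
  exact: measurableX.
have -> : (fun p : T j * pcar (iterprod s) =>
   @dfwith I (fun j => T j) (assemble p.2) j p.1) @^-1` [set w | A (w i)]
   = setT `*` (@assemble s @^-1` [set w | A (w i)]).
  apply/seteqP; split=> [[x y]|[x y]] /=; rewrite dfwithout//.
  by case.
exact: measurableX.
Qed.

HB.instance Definition _ s :=
  isMeasurableFun.Build _ _ _ _ (@assemble s) (@measurable_assemble s).

Definition prod_prob : probability prodT R :=
  distribution (pmeas (iterprod (enum I))) (@assemble (enum I)).

Lemma prod_prob_box (A : forall i, set (T i)) :
  (forall i, measurable (A i)) ->
  prod_prob [set w | forall i, A i (w i)] = (\prod_i P i (A i))%E.
Proof.
move=> mA.
have H s : uniq s -> pmeas (iterprod s)
    (@assemble s @^-1` [set w | forall i, i \in s -> A i (w i)])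
    = (\prod_(i <- s) P i (A i))%E.
  elim: s => [_|i s ih /= /andP[iNs us]].
    rewrite big_nil [X in pmeas _ X](_ : _ = setT) ?probability_setT//.
    by apply/seteqP; split.
  rewrite big_cons -ih//=.
  have -> : (fun p : T i * pcar (iterprod s) =>
     @dfwith I (fun j => T j) (@assemble s p.2) i p.1) @^-1`
     [set w | forall j, j \in i :: s -> A j (w j)] =
     A i `*` (@assemble s @^-1` [set w | forall j, j \in s -> A j (w j)]).
    apply/seteqP; split=> [[x y] /= h|[x y] /= [Ax h] j].
      split; first by have := h i (mem_head _ _); rewrite dfwithin.
      move=> j js; have := h j; rewrite in_cons js orbT => /(_ isT).
      by rewrite dfwithout//; apply: contraNneq iNs => ->.
    rewrite in_cons; have [->|ji /= js] := eqVneq j i.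
      by rewrite dfwithin.
    by rewrite dfwithout 1?eq_sym//; exact: h.
  rewrite product_measure1E//.
  rewrite -[X in measurable X]setTI; apply: measurable_assemble => //.
  pose C j : set prodT := [set w | A j (w j)].
  rewrite [X in measurable X](_ : _ = \bigcap_(j in [set` s]) C j);
    last by apply/seteqP; split.
  apply: fin_bigcap_measurable => [|j _]; first exact: finite_finset.
  by apply: sub_sigma_algebra; exists j, (A j).
have := H _ (enum_uniq I); rewrite -big_enum/= => <-.
rewrite /prod_prob /= /distribution /pushforward; congr (pmeas _ (_ @^-1` _)).
by apply/seteqP; split=> w /= h i //; apply: h; rewrite mem_enum.
Qed.

End product_probability.

Variant ty := TBool | TInt | TReal.

Definition disp (R : realType) (t : ty) : measure_display :=
  match t with
  | TBool | TInt => default_measure_display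
  | TReal => (R.-ocitv.-measurable).-sigma
  end.

Definition dom (R : realType) (t : ty) : measurableType (disp R t) :=
  match t with
  | TBool => bool
  | TInt => int
  | TReal => measurableTypeR R
  end.

Section uniform.
Context (R : realType).

Definition int_range (a b : R) : set int := [set n | a <= n%:~R <= b].

Lemma measurable_int_range a b : measurable (int_range a b).
Proof. by []. Qed.

(* The counting measure restricted to the integers of [a, b], normalized; the
   Dirac measure is a dummy for the excluded case of an empty range. *)
Definition uniform_int (a b : R) : probability int R :=
  mnormalize (mrestr (counting : {measure set int -> \bar R})
                     (measurable_int_range a b)) \d_(0 : int).

(* [uniform_prob] needs a nondegenerate interval; Uniform(a, a) is the point
   mass at a. *)
Definition uniform_real (a b : R) : probability (measurableTypeR R) R :=
  match pselect (a < b) with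
  | left ab => uniform_prob ab
  | right _ => \d_(a : measurableTypeR R)
  end.

(* Boolean variables are never sampled, see [cfa_sample]. *)
Definition uniform (t : ty) : R -> R -> probability (dom R t) R :=
  match t return R -> R -> probability (dom R t) R with
  | TBool => fun _ _ => \d_false
  | TInt => uniform_int
  | TReal => uniform_real
  end.

Definition nonempty_range (t : ty) (a b : R) : Prop :=
  match t with
  | TBool => False
  | TInt => int_range a b !=set0
  | TReal => a <= b
  end.

End uniform.

(* The expression language is an arbitrary typed first-order language over the
   Booleans, the integers and the reals. *)
Record signature (R : realType) := Signature {
  op : Type;
  arity : op -> nat;
  arg_ty : forall o : op, 'I_(arity o) -> ty;
  res_ty : op -> ty;
  interp : forall o : op, (forall i, dom R (@arg_ty o i)) -> dom R (res_ty o) }.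

Section syntax.
Context (R : realType) (Sg : signature R) (Var : finType) (vty : Var -> ty).

Inductive expr : ty -> Type :=
| EVar (x : Var) : expr (vty x)
| EApp (o : op Sg) (args : forall i, expr (@arg_ty R Sg o i)) : expr (res_ty o).

Definition valuation := forall x : Var, dom R (vty x).

Definition update (s : valuation) (x : Var) (v : dom R (vty x)) : valuation :=
  @dfwith Var (fun y => dom R (vty y)) s x v.

Fixpoint eval_expr (s : valuation) (t : ty) (e : expr t) : dom R t :=
  match e with
  | EVar x => s x
  | EApp o args => interp (fun i => eval_expr s (args i))
  end.

Fixpoint occurs (x : Var) (t : ty) (e : expr t) : bool :=
  match e with
  | EVar y => x == y
  | EApp o args => [exists i, occurs x (args i)]
  end.

Definition holds (s : valuation) (psi : expr TBool) : Prop :=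
  is_true (eval_expr s psi : bool).

Inductive stmt : Type :=
| Skip
| Assign (x : Var) (e : expr (vty x))
| Sample (x : Var) (a b : R)
| Assume (psi : expr TBool).

Definition assigns (x : Var) (c : stmt) : bool :=
  match c with
  | Assign y _ | Sample y _ _ => x == y
  | _ => false
  end.

Definition samples (x : Var) (c : stmt) : bool :=
  if c is Sample y _ _ then x == y else false.

Definition reads (x : Var) (c : stmt) : bool :=
  match c with
  | Assign _ e => occurs x e
  | Assume psi => occurs x psi
  | _ => false
  end.

Section graph.
Context (V : finType).

Definition edge : Type := V * stmt * V.
Definition src (e : edge) : V := e.1.1.
Definition lab (e : edge) : stmt := e.1.2.
Definition tgt (e : edge) : V := e.2.

Fixpoint is_path (E : seq edge) (u : V) (p : seq edge) (w : V) : Prop :=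
  match p with
  | [::] => u = w
  | e :: p' => [/\ List.In e E, src e = u & is_path E (tgt e) p' w]
  end.

Inductive formula : Type :=
| FTrue
| FFalse
| FBlock (v : V)
| FPred (psi : expr TBool)
| FEq (x : Var) (e : expr (vty x))
| FAnd (f g : formula)
| FOr (f g : formula)
| FImp (f g : formula)
| FExBlock (v : V) (f : formula)
| FExVar (x : Var) (f : formula).

Fixpoint sat (b : V -> bool) (s : valuation) (f : formula) : Prop :=
  match f with
  | FTrue => True
  | FFalse => False
  | FBlock v => b v
  | FPred psi => holds s psi
  | FEq x e => s x = eval_expr s e
  | FAnd f g => sat b s f /\ sat b s g
  | FOr f g => sat b s f \/ sat b s g
  | FImp f g => sat b s f -> sat b s g
  | FExBlock v f => exists c : bool, sat [eta b with v |-> c] s f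
  | FExVar x f => exists c : dom R (vty x), sat b (update s c) f
  end.

Definition big_and : seq formula -> formula := foldr FAnd FTrue.
Definition big_or : seq formula -> formula := foldr FOr FFalse.
Definition ex_blocks (vs : seq V) (f : formula) : formula :=
  foldr FExBlock f vs.
Definition ex_vars (xs : seq Var) (f : formula) : formula := foldr FExVar f xs.

End graph.
End syntax.

Arguments Skip {R Sg Var vty}.
Arguments FTrue {R Sg Var vty V}.
Arguments FFalse {R Sg Var vty V}.
Arguments FBlock {R Sg Var vty V} v.

Record cfa (R : realType) (Sg : signature R) := Cfa {
  Var : finType;
  vty : Var -> ty;
  Vtx : finType;
  edges : seq (edge Sg vty Vtx);
  vinit : Vtx;
  vacc : Vtx;
  vrej : Vtx;
  cfa_acyclic : forall u p, is_path edges u p u -> p = [::];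
  cfa_init : forall e, List.In e edges -> tgt e <> vinit;
  cfa_acc : forall e, List.In e edges -> src e <> vacc;
  cfa_rej : forall e, List.In e edges -> src e <> vrej;
  cfa_sample : forall u w x a b,
    List.In (u, Sample Sg vty x a b, w) edges -> nonempty_range (vty x) a b }.

Section semantics.
Context (R : realType) (Sg : signature R) (P : cfa Sg).

Local Notation edge := (edge Sg (@vty R Sg P) (Vtx P)).
Local Notation stmt := (stmt Sg (@vty R Sg P)).
Local Notation formula := (formula Sg (@vty R Sg P) (Vtx P)).
Local Notation valuation := (valuation R (@vty R Sg P)).
Local Notation path := (is_path (edges P)).

Definition random (x : Var P) : bool :=
  has (fun e : edge => samples x (lab e)) (edges P).

Definition rvar : Type := {x : Var P | random x}.

(* Static single assignment form. [ssa_once] alone does not give the usual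
   meaning of a variable as a single value: the read [x := x + 1], the sequence
   [assume (x > 0); x := -1], a deterministic assignment to a sampled variable
   on another branch, or a read of a sampled variable on a branch that does not
   sample it, all satisfy it and all break the correspondence between runs and
   models. The other fields spell out what single assignment form excludes. *)
Record ssa : Prop := Ssa {
  ssa_once : forall u p w x, path u p w ->
    (count (fun e : edge => assigns x (lab e)) p <= 1)%N;
  ssa_random : forall (e e' : edge) x,
    List.In e (edges P) -> List.In e' (edges P) ->
    samples x (lab e) -> assigns x (lab e') -> lab e' = lab e;
  ssa_read : forall p (e : edge) q w x, path (vinit P) (p ++ e :: q) w ->
    reads x (lab e) ->
    ~~ has (fun e : edge => assigns x (lab e)) (e :: q);
  ssa_read_random : forall p (e : edge) w x, path (vinit P) (rcons p e) w ->
    reads x (lab e) -> random x ->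
    has (fun e : edge => samples x (lab e)) p }.

Definition bounds_in (x : Var P) (c : stmt) : option (R * R) :=
  if c is Sample y a b then if x == y then Some (a, b) else None else None.

(* The bounds of the first sampling of [x]; they do not depend on this choice
   by [ssa_random]. *)
Definition bounds (x : Var P) : R * R :=
  head (0, 0) (pmap (fun e : edge => bounds_in x (lab e)) (edges P)).

Definition dist (r : rvar) : probability (dom R (vty (val r))) R :=
  uniform (vty (val r)) (bounds (val r)).1 (bounds (val r)).2.

Definition scenario : Type := forall r : rvar, dom R (vty (val r)).

Definition Pr (A : set scenario) : \bar R := prod_prob dist A.

Definition step (w : scenario) (c : stmt) (s s' : valuation) : Prop :=
  match c with
  | Skip => s' = s
  | Assign x e => s' = update s (eval_expr s e)
  | Sample x _ _ => exists2 r : rvar, val r = x & s' = update s (w r)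
  | Assume psi => holds s psi /\ s' = s
  end.

Fixpoint run (w : scenario) (p : seq edge) (s s' : valuation) : Prop :=
  match p with
  | [::] => s' = s
  | e :: p' => exists2 s1, step w (lab e) s s1 & run w p' s1 s'
  end.

Definition reaches (w : scenario) (u : Vtx P) : Prop :=
  exists p s s', path (vinit P) p u /\ run w p s s'.

Definition Term : set scenario :=
  [set w | reaches w (vacc P) \/ reaches w (vrej P)].

Definition Accept : set scenario := [set w | reaches w (vacc P)].

Definition cond_Pr (A B : set scenario) : R := fine (Pr (A `&` B)) / fine (Pr B).

Definition value : R := cond_Pr Accept Term.

Definition well_formed : Prop := exists2 eps : R, 0 < eps & (eps%:E <= Pr Term)%E.

Definition Psi (c : stmt) : formula :=
  match c with
  | Skip => FTrue
  | Assign x e => FEq (Vtx P) e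
  | Sample _ _ _ => FTrue
  | Assume psi => FPred (Vtx P) psi
  end.

Definition in_edges (v : Vtx P) : seq edge :=
  [seq e <- edges P | tgt e == v].

Definition VC : formula :=
  FAnd
    (big_and
      [seq FImp (FBlock v)
             (big_or [seq FAnd (FBlock (src e)) (Psi (lab e)) | e <- in_edges v])
      | v <- enum (Vtx P) & v != vinit P])
    (FBlock (vinit P)).

Definition ex_nonrandom (f : formula) : formula :=
  ex_blocks (enum (Vtx P))
    (ex_vars [seq x <- enum (Var P) | ~~ random x] f).

Definition phi_acc : formula := ex_nonrandom (FAnd VC (FBlock (vacc P))).

Definition phi_term : formula :=
  ex_nonrandom (FAnd VC (FOr (FBlock (vacc P)) (FBlock (vrej P)))).

(* The free variables of [f] are meant to be random; the values given to the
   other variables are then irrelevant. *)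
Definition models (f : formula) : set scenario :=
  [set w | forall b s, (forall r : rvar, s (val r) = w r) -> sat b s f].

Definition measure_models (f : formula) : R := fine (Pr (models f)).

End semantics.

Arguments Term {R Sg} P _.
Arguments Accept {R Sg} P _.

(* Main.v *)
(** A model of the verification condition marks a set of blocks, each of which
    other than the initial one has a marked predecessor along an edge whose
    constraint holds; acyclicity makes this backward walk end in the initial
    vertex, and the valuation of the model is a constant run along the path so
    obtained. Conversely, mark the vertices visited by a run. In single
    assignment form a variable does not change once it is read or assigned, so
    the final valuation of the run satisfies every constraint met on the way;
    the random variables that were not sampled on the way are never read there,
    and may be given the values prescribed by the scenario. *)
Require Import Defs.
From mathcomp Require Import all_boot all_order all_algebra.
From mathcomp Require Import all_classical all_reals all_analysis.
Set Implicit Arguments.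
Unset Strict Implicit.
Unset Printing Implicit Defensive.
Local Open Scope ring_scope.

(** * Membership by [List.In]: edges carry expressions without decidable equality *)

Lemma has_InP (T : Type) (a : pred T) (s : seq T) :
  has a s <-> exists2 x, List.In x s & a x.
Proof.
elim: s => [|x s ih] /=; first by split=> // -[].
split=> [/orP[ax|/ih[y sy ay]]|[y [->|sy] ay]].
- by exists x; [left|].
- by exists y; [right|].
- by rewrite ay.
- by apply/orP; right; apply/ih; exists y.
Qed.

Lemma In_filter (T : Type) (a : pred T) (s : seq T) x :
  List.In x (seq.filter a s) <-> List.In x s /\ a x.
Proof.
elim: s => [|y s ih] /=; first by split=> // -[].
case: ifPn => [ay|/negP nay] /=; rewrite ih; split.
- by move=> [<-|[sx ax]]; split=> //; [left|right].
- by move=> [[->|sx] ax]; [left|right].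
- by move=> [sx ax]; split=> //; right.
- by move=> [[yx|sx] ax]; [rewrite yx in nay|split].
Qed.

(** * Satisfaction of formulas, and concatenation of paths *)

Section formulas.
Context (R : realType) (Sg : signature R) (Var : finType) (vty : Var -> ty).
Context (V : finType).
Implicit Types (b c : V -> bool) (s t : valuation R vty).
Implicit Types (f : formula Sg vty V).

Lemma eq_eval_expr s t (k : ty) (e : expr Sg vty k) :
  (forall x, occurs x e -> s x = t x) -> eval_expr s e = eval_expr t e.
Proof.
elim: e => [x|o args ih] /= st; first exact/st.
congr interp; apply: functional_extensionality_dep => i.
by apply: ih => x xi; apply: st; apply/existsP; exists i.
Qed.

Lemma update_id s (x : Var) : update s (s x) = s.
Proof.
apply: functional_extensionality_dep => y; rewrite /update.
by have [<-|xy] := eqVneq x y; rewrite ?dfwithin ?dfwithout.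
Qed.

Lemma sat_big_and (I : eqType) (F : I -> formula Sg vty V) (r : seq I) b s :
  sat b s (big_and (map F r)) <-> forall i, i \in r -> sat b s (F i).
Proof.
elim: r => [|i r ih] //=; split=> [[Fi /ih Fr] j|Fr].
  by rewrite in_cons => /predU1P[->|/Fr].
split; first exact/Fr/mem_head.
by apply/ih => j rj; apply: Fr; rewrite in_cons rj orbT.
Qed.

Lemma sat_big_or (I : Type) (F : I -> formula Sg vty V) (r : seq I) b s :
  sat b s (big_or (map F r)) <-> exists2 i, List.In i r & sat b s (F i).
Proof.
elim: r => [|i r ih] /=; first by split=> // -[].
split=> [[Fi|/ih[j rj Fj]]|[j [->|rj] Fj]].
- by exists i; [left|].
- by exists j; [right|].
- by left.
- by right; apply/ih; exists j.
Qed.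

(** Successive one-point changes along [vs] amount to one simultaneous change on [vs]. *)
Lemma sat_ex_blocks (vs : seq V) f b s :
  sat b s (ex_blocks vs f) <->
  exists2 c, (forall v, v \notin vs -> c v = b v) & sat c s f.
Proof.
elim: vs b => [|v vs ih] b /=.
  split=> [fb|[c cb]]; first by exists b.
  by rewrite (_ : c = b)//; apply/funext => v; exact: cb.
split=> [[x /ih[c cb fc]]|[c cb fc]].
  exists c => // u; rewrite in_cons negb_or => /andP[uv uvs].
  by rewrite cb//= (negbTE uv).
exists (c v); apply/ih; exists c => // u uvs /=.
by have [->//|uv] := eqVneq u v; rewrite cb// in_cons negb_or uv.
Qed.

Lemma sat_ex_vars (xs : seq Var) f b s :
  sat b s (ex_vars xs f) <->
  exists2 t, (forall x, x \notin xs -> t x = s x) & sat b t f.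
Proof.
elim: xs s => [|x xs ih] s /=.
  split=> [fs|[t ts]]; first by exists s.
  by rewrite (_ : t = s)//; apply: functional_extensionality_dep => x; exact: ts.
split=> [[c /ih[t ts ft]]|[t ts ft]].
  exists t => // y; rewrite in_cons negb_or => /andP[yx yxs].
  by rewrite ts// /update dfwithout// eq_sym.
exists (t x); apply/ih; exists t => // y yxs; rewrite /update.
have [<-|xy] := eqVneq x y; first by rewrite dfwithin.
by rewrite dfwithout// ts// in_cons negb_or eq_sym xy.
Qed.

Lemma is_path_cat (E : seq (edge Sg vty V)) u p q w :
  is_path E u (p ++ q) w <-> exists2 v, is_path E u p v & is_path E v q w.
Proof.
elim: p u => [|e p ih] u /=; first by split=> [uq|[v ->]//]; exists u.
split=> [[Ee eu /ih[v pv qv]]|[v [Ee eu pv] qv]]; first by exists v.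
by split=> //; apply/ih; exists v.
Qed.

Lemma is_path_In (E : seq (edge Sg vty V)) u p w e :
  is_path E u p w -> List.In e p -> List.In e E.
Proof. by elim: p u => [//|e' p ih] u /= [Ee' _ /ih pe] [<-|/pe]. Qed.

End formulas.

(** * Induction along the edges of an acyclic graph *)

Section acyclic.
Context (R : realType) (Sg : signature R) (P : cfa Sg).
Local Notation path := (is_path (edges P)).

(** Only nonempty paths count, so that by acyclicity no vertex is its own ancestor. *)
Definition ancestors (u : Vtx P) : {set Vtx P} :=
  [set v | `[< exists e p, path v (e :: p) u >]].

Lemma ancestors_proper e :
  List.In e (edges P) -> ancestors (src e) \proper ancestors (tgt e).
Proof.
move=> Ee; apply/properP; split.
  apply/fintype.subsetP => v; rewrite !inE => -[e' [p vp]].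
  exists e', (p ++ [:: e]).
  by rewrite -cat_cons; apply/is_path_cat; exists (src e).
exists (src e); rewrite inE.
  by apply/asboolP; exists e, [::].
by apply/asboolP => -[e' [p /cfa_acyclic]].
Qed.

(** Passing from a vertex to a predecessor strictly decreases the number of ancestors. *)
Lemma edge_ind (Q : Vtx P -> Prop) :
  (forall u, (forall e, List.In e (edges P) -> tgt e = u -> Q (src e)) -> Q u) ->
  forall u, Q u.
Proof.
move=> step u; have [n] := ubnP #|ancestors u|.
elim: n u => // n ih u un; apply: step => e Ee eu; apply: ih.
by apply: leq_trans (proper_card (ancestors_proper Ee)) _; rewrite eu.
Qed.

End acyclic.

Section verification_condition.
Context (R : realType) (Sg : signature R) (P : cfa Sg).
Local Notation path := (is_path (edges P)).
Local Notation valuation := (valuation R (@vty R Sg P)).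
Local Notation edge := (edge Sg (@vty R Sg P) (Vtx P)).
Implicit Types (w : scenario P) (s t : valuation) (b : Vtx P -> bool).
Implicit Types (p q : seq edge) (e : edge) (u v : Vtx P).

(** * Valuations agreeing with a scenario, and models *)

Definition consistent w s : Prop := forall r : rvar P, s (val r) = w r.

Definition override w s : valuation := fun x =>
  match pselect (random x) with left h => w (exist _ x h) | right _ => s x end.

Lemma override_consistent w s : consistent w (override w s).
Proof.
move=> [x h] /=; rewrite /override; case: pselect => // h'.
by rewrite (bool_irrelevance h' h).
Qed.

Lemma override_nonrandom w s x : ~~ random x -> override w s x = s x.
Proof. by move=> /negP h; rewrite /override; case: pselect. Qed.

Lemma sat_VC b s :
  sat b s (VC P) <->
  b (vinit P) /\
  forall v, v != vinit P -> b v ->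
    exists e, [/\ List.In e (edges P), tgt e = v, b (src e)
                & sat b s (Psi (lab e))].
Proof.
rewrite /VC /=; split=> [[/sat_big_and H bi]|[bi H]]; split=> //.
  move=> v vi bv; have := H v; rewrite mem_filter vi mem_enum => /(_ isT) /=.
  by move=> /(_ bv)/sat_big_or[e /In_filter[Ee /eqP ev] /= [be se]]; exists e.
apply/sat_big_and => v; rewrite mem_filter => /andP[vi _] /= bv.
have [e [Ee ev be se]] := H v vi bv; apply/sat_big_or; exists e => //.
by apply/In_filter; split=> //; exact/eqP.
Qed.

(** The quantifiers of [ex_nonrandom] rebind every block and every nonrandom variable, so the
    ambient [b] and [s] matter only through the scenario. *)
Lemma modelsE f w :
  models (ex_nonrandom f) w <-> exists b s, consistent w s /\ sat b s f.
Proof.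
split=> [H|[b [s [sw fs]]] b' s' s'w].
  (* Any valuation consistent with [w] serves to instantiate [models]; [point] fills the nonrandom
     variables. *)
  have s0w := override_consistent w (fun=> point).
  have /sat_ex_blocks[b _ /sat_ex_vars[s ss0 fs]] := H xpred0 _ s0w.
  exists b, s; split=> // r; rewrite -s0w ss0// mem_filter.
  by rewrite (valP r).
apply/sat_ex_blocks; exists b => [v|]; first by rewrite mem_enum.
apply/sat_ex_vars; exists s => // x; rewrite mem_filter mem_enum andbT negbK.
by move=> rx; rewrite (sw (exist _ x rx)) (s'w (exist _ x rx)).
Qed.

(** * From models to runs *)

Lemma run_cat w p q s t :
  run w (p ++ q) s t <-> exists2 s', run w p s s' & run w q s' t.
Proof.
elim: p s => [|e p ih] s /=; first by split=> [sq|[s' ->]//]; exists s.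
split=> [[s1 es /ih[s' ps qs]]|[s' [s1 es ps] qs]].
  by exists s' => //; exists s1.
by exists s1 => //; apply/ih; exists s'.
Qed.

(** The variable written by [e] already holds its new value in [s], by the equation or by
    consistency, so the update changes nothing. *)
Lemma sat_Psi_step w b s e :
  consistent w s -> List.In e (edges P) -> sat b s (Psi (lab e)) ->
  step w (lab e) s s.
Proof.
move=> sw Ee; case le: (lab e) => [|x ex|x lo hi|psi] //= H.
- by rewrite -H update_id.
- have rx : random x by apply/has_InP; exists e; rewrite // le /=.
  by exists (exist _ x rx); rewrite //= -sw update_id.
Qed.

Lemma sat_VC_reaches w b s u :
  consistent w s -> sat b s (VC P) -> b u -> reaches w u.
Proof.
move=> sw /sat_VC[bi H] bu.
(* Asking for a run that stays at [s] lets the runs given by the induction be extended edge by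
   edge. *)
suff [p pu rp] : exists2 p, path (vinit P) p u & run w p s s by exists p, s, s.
elim/edge_ind: u bu => u ih bu.
have [->|ui] := eqVneq u (vinit P); first by exists [::].
have [e [Ee eu be se]] := H u ui bu.
have [p pe rp] := ih e Ee eu be.
exists (p ++ [:: e]); first by apply/is_path_cat; exists (src e).
apply/run_cat; exists s => //=; exists s => //.
exact: sat_Psi_step se.
Qed.

(** * From runs to models *)

Lemma step_unassigned w c s t x :
  step w c s t -> ~~ assigns x c -> t x = s x.
Proof.
case: c => [|y ey|y lo hi|psi] /=.
- by move=> ->.
- by move=> -> xy; rewrite /update dfwithout// eq_sym.
- by move=> [r ry ->] xy; rewrite /update dfwithout// ry eq_sym.
- by move=> [_ ->].
Qed.

Lemma run_unassigned w p s t x :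
  run w p s t -> ~~ has (fun e => assigns x (lab e)) p -> t x = s x.
Proof.
elim: p s => [|e p ih] s /=; first by move=> ->.
by move=> [s1 es /ih ps]; rewrite negb_or => /andP[/(step_unassigned es) <- /ps].
Qed.

Lemma step_samples w c s t (r : rvar P) :
  step w c s t -> samples (val r) c -> t (val r) = w r.
Proof.
case: c => //= y lo hi [r' r'y ->] /eqP ry.
have -> : r' = r := val_inj (etrans r'y (esym ry)).
by rewrite /update dfwithin.
Qed.

(** After the last sampling of [r] nothing assigns it, since by [ssa_random] every assignment to [r]
    is a sampling. *)
Lemma run_sampled w p s t u v (r : rvar P) :
  ssa P -> path u p v -> run w p s t ->
  has (fun e => samples (val r) (lab e)) p -> t (val r) = w r.
Proof.
move=> hssa; elim: p u s => [//|e p ih] u s /= [Ee _ pv] [s1 es ps].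
have [sp _|nsp] := boolP (has (fun e => samples (val r) (lab e)) p).
  exact: ih pv ps sp.
rewrite orbF => re; rewrite -(step_samples es re).
apply: run_unassigned ps _; apply: contra nsp => /has_InP[e' pe' ae'].
apply/has_InP; exists e' => //.
by rewrite (ssa_random hssa Ee (is_path_In pv pe') re ae').
Qed.

Lemma run_sat_Psi w b p e q s t u :
  ssa P -> path (vinit P) (p ++ e :: q) u -> run w (p ++ e :: q) s t ->
  sat b (override w t) (Psi (lab e)).
Proof.
move=> hssa pu /run_cat[s1 ps] /[dup] eqs /= [s2 es qs].
have [v pv [Ee ev qu]] := (is_path_cat _ _ _ _ _).1 pu.
(* What [e] reads is already final: a nonrandom variable is not assigned by [e] or later
   ([ssa_read]), and a random one was sampled before ([ssa_read_random]), hence has the value of the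
   scenario. *)
have read x : reads x (lab e) -> override w t x = s1 x.
  move=> xe; have [rx|nrx] := boolP (random x); last first.
    rewrite override_nonrandom//.
    exact: run_unassigned eqs (ssa_read hssa pu xe).
  have pe : path (vinit P) (rcons p e) (tgt e).
    by rewrite -cats1; apply/is_path_cat; exists v.
  have px := ssa_read_random hssa pe xe rx.
  rewrite (override_consistent w t (exist _ x rx)).
  by rewrite -(run_sampled (r := exist _ x rx) hssa pv ps px).
case le: (lab e) => [|x ex|x lo hi|psi] //=; rewrite le /= in es read.
- have nrx : ~~ random x.
    apply/negP => /has_InP[e' Ee' xe'].
    have xe : assigns x (lab e) by rewrite le /=.
    by have := ssa_random hssa Ee' Ee xe' xe; rewrite le => e'e; rewrite -e'e in xe'.
  rewrite override_nonrandom// (run_unassigned qs (x := x)).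
    by rewrite es /update dfwithin; apply/esym/eq_eval_expr.
  (* The edge [e] uses up the only assignment to [x] on the path, so none is left in [q]. *)
  have := ssa_once hssa x pu.
  rewrite count_cat /= le /= eqxx has_count -leqNgt addnCA -[leqRHS]addn0.
  by rewrite leq_add2l leqn0 addn_eq0 leqn0 => /andP[].
- by case: es => + _; rewrite /holds (eq_eval_expr read).
Qed.

Definition visited (p : seq edge) u : bool :=
  (u == vinit P) || has (fun e => tgt e == u) p.

Lemma visited_last p u : path (vinit P) p u -> visited p u.
Proof.
rewrite /visited; elim/last_ind: p => [<-|p e _]; first by rewrite eqxx.
rewrite -cats1 => /is_path_cat[v _ [_ _ <-]].
by rewrite has_cat /= eqxx !orbT.
Qed.

(** A visited vertex other than [vinit P] is the target of an edge of the path; the source of that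
    edge ends the prefix before it, hence is visited too. *)
Lemma reaches_sat_VC w u :
  ssa P -> reaches w u ->
  exists b s, [/\ consistent w s, sat b s (VC P) & b u].
Proof.
move=> hssa [p [s [t [pu ps]]]].
exists (visited p), (override w t); split; last exact: visited_last.
  exact: override_consistent.
apply/sat_VC; split=> [|v vi]; first by rewrite /visited eqxx.
rewrite /visited (negbTE vi) => /has_InP[e pe /eqP ev]; exists e.
have [p1 [p2 p12]] := List.in_split _ _ pe.
rewrite p12 in pu ps *.
have [v' pv' [Ee ev' _]] := (is_path_cat _ _ _ _ _).1 pu.
split=> //; last exact: run_sat_Psi hssa pu ps.
rewrite ev'; have := visited_last pv'; rewrite /visited has_cat.
by case/orP => ->; rewrite ?orbT.
Qed.

Lemma reachesP w u : ssa P ->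
  reaches w u <->
  exists b s, consistent w s /\ (sat b s (VC P) /\ b u).
Proof.
move=> hssa; split=> [/(reaches_sat_VC hssa)[b [s [sw vc bu]]]|].
  by exists b, s.
by move=> [b [s [sw [vc bu]]]]; exact: sat_VC_reaches sw vc bu.
Qed.

(** * Equality of the events and of their measures *)

Lemma Accept_models : ssa P -> Accept P = models (phi_acc P).
Proof.
move=> hssa; apply/funext => w; apply/propext.
by rewrite modelsE /=; exact: reachesP.
Qed.

Lemma Term_models : ssa P -> Term P = models (phi_term P).
Proof.
move=> hssa; apply/funext => w; apply/propext.
rewrite modelsE /Term /= !reachesP//; split.
  move=> [] [b [s [sw [vc bu]]]]; exists b, s; split=> //; split=> //.
    by left.
  by right.
by move=> [b [s [sw [vc [bu|bu]]]]]; [left|right]; exists b, s.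
Qed.

End verification_condition.

Theorem theorem3 (R : realType) (Sg : signature R) (P : cfa Sg)
    (hssa : ssa P) (hwf : well_formed P) :
  [/\ Accept P = models (phi_acc P),
      Term P = models (phi_term P) &
      value P = measure_models (phi_acc P) / measure_models (phi_term P)].
Proof.
split; [exact: Accept_models|exact: Term_models|].
rewrite /measure_models -Accept_models// -Term_models// /value /cond_Pr.
(* [Accept P] is contained in [Term P], so conditioning leaves the numerator equal to the measure of
   [Accept P]. *)
by congr (fine (Pr _) / _); apply: setIidl => w; left.
Qed.
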